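(* Let $a\neq 0,-1$ and $N$ be real numbers, let $k\ge 1$ be an integer, let $P_1$ be a real polynomial of degree $k+1$, and write $P_2(x)=P_1(x-1-a)-P_1(x)$ (so that $P_2$ is a polynomial of degree $k$). Assume that $P_2(-n(1+a))\neq 0$ for $n\ge 0$, and define $$\gamma_{n+1}=P_2(-n(1+a))\ (n\ge 0),\qquad \lambda_n=P_1(-n(1+a))\ (n\ge 0),\qquad \beta_n=\frac{1}{1+a}\frac{\gamma_{n+1}}{\gamma_n}\ (n\ge 1),$$ and the polynomials $q_0=1$ and $q_n(x)=k_n^{a,N}(x)+\beta_nk_{n-1}^{a,N}(x)$ for $n\ge 1$, where $(k_n^{a,N})_n$ are the Krawtchouk polynomials. Let $$D=P_1(D_{a,N})+\frac{1}{1+a}\nabla P_2(D_{a,N}),$$ where $D_{a,N}$ is the second order Krawtchouk difference operator. Then $D$ is a difference operator of order $2k+2$ and genre $(-k-1,k+1)$, and $D(q_n)=\lambda_nq_n$ for all $n\ge 0$.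
   Context: For $l\in\mathbb{Z}$ the shift operator $\mathfrak{s}_l$ acts on polynomials by $\mathfrak{s}_l(f)(x)=f(x+l)$; $\nabla f(x)=f(x)-f(x-1)$. A finite difference operator $\sum_{l=s}^r f_l\,\mathfrak{s}_l$ (with polynomial coefficients $f_l$) with $f_s,f_r\neq 0$ has order $r-s$ and genre $(s,r)$. For a linear operator $T$ and a polynomial $P(x)=\sum_j a_jx^j$, $P(T)=\sum_j a_jT^j$; products of operators are compositions. $(y)_j=y(y+1)\cdots(y+j-1)$, $(y)_0=1$. Krawtchouk polynomials ($a\neq 0,-1$, $N\in\mathbb{R}$): $k_n^{a,N}(x)=\frac{1}{n!}\sum_{j=0}^n(-1)^{n+j}\frac{(1+a)^{j-n}}{a^{j-n}}\frac{(-n)_j(-x)_j(N-n)_{n-j}}{j!}$. Krawtchouk operator: $D_{a,N}=x\,\mathfrak{s}_{-1}-(x-a(x-N+1))\,\mathfrak{s}_0-a(x-N+1)\,\mathfrak{s}_1$, which satisfies $D_{a,N}(k_n^{a,N})=-n(1+a)k_n^{a,N}$. *)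

(* Defs.v *)
From HB Require Import structures.
From mathcomp Require Import all_boot all_order all_algebra.
From mathcomp Require Import reals.

Set Implicit Arguments.
Unset Strict Implicit.
Unset Printing Implicit Defensive.

Import Order.TTheory GRing.Theory Num.Theory.
Local Open Scope ring_scope.

Definition shift (R : realType) (l : int) (f : {poly R}) : {poly R} :=
  f \Po ('X + (l%:~R)%:P).

Definition nabla (R : realType) (f : {poly R}) : {poly R} := f - shift (-1) f.

(* T has genre (s, r) when T = f_s s_s + ... + f_r s_r as a map on polynomials,
   with f_s and f_r nonzero.  Since R has characteristic 0, distinct shifts are
   linearly independent over {poly R}, so s, r and the f_l (s <= l <= r) are
   determined by the map T. *)
Definition has_genre (R : realType) (T : {poly R} -> {poly R}) (s r : int)
    : Prop :=
  s <= r /\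
  exists c : int -> {poly R},
    [/\ c s != 0, c r != 0 &
        forall f : {poly R},
          T f = \sum_(i < (absz (r - s)).+1) c (s + i%:Z) * shift (s + i%:Z) f].

Definition has_order (R : realType) (T : {poly R} -> {poly R}) (m : nat)
    : Prop :=
  exists s r : int, has_genre T s r /\ r - s = m%:Z.

Definition poly_op (R : realType) (P : {poly R}) (T : {poly R} -> {poly R})
    (f : {poly R}) : {poly R} :=
  \sum_(j < size P) P`_j *: iter j T f.

(* Stated over a general ring: used for real numbers and for the polynomial
   - 'X. *)
Definition pochhammer (A : pzRingType) (y : A) (j : nat) : A :=
  \prod_(i < j) (y + i%:R).

(* The exponents j - n are nonpositive integers. *)
Definition krawtchouk (R : realType) (a N : R) (n : nat) : {poly R} :=
  (n`!%:R)^-1 *: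
  \sum_(j < n.+1)
    ((-1) ^+ (n + j)
     * ((1 + a) ^ (j%:Z - n%:Z) / a ^ (j%:Z - n%:Z))
     * (pochhammer (- n%:R) j * pochhammer (N - n%:R) (n - j) / j`!%:R))
    *: pochhammer (- 'X) j.

Definition krawtchouk_op (R : realType) (a N : R) (f : {poly R}) : {poly R} :=
  'X * shift (-1) f
  - ('X - a *: ('X - N%:P + 1)) * shift 0 f
  - (a *: ('X - N%:P + 1)) * shift 1 f.

(* Main.v *)
Require Import Defs.
From HB Require Import structures.
From mathcomp Require Import all_boot all_order all_algebra.
From mathcomp Require Import reals.
From mathcomp Require Import ring zify.

Set Implicit Arguments.
Unset Strict Implicit.
Unset Printing Implicit Defensive.

Import Order.TTheory GRing.Theory Num.Theory.
Local Open Scope ring_scope.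

(** Write k_n for the Krawtchouk polynomials, d for the second order operator
    D_{a,N} and r = a / (1 + a).

    Eigenfunctions.  Since d k_n = - n (1 + a) k_n, a polynomial P in d
    multiplies k_n by P(- n (1 + a)): P1 gives lambda_n and P2 gives
    gamma_(n+1).  Because beta_n gamma_n = gamma_(n+1) / (1 + a), applying
    P2(d) to q_n = k_n + beta_n k_(n-1) produces
    gamma_(n+1) (k_n + k_(n-1) / (1 + a)), and the backward difference of the
    bracket is k_(n-1) (nabla_krawtchouk).  So D q_n differs from
    lambda_n k_n + beta_n lambda_(n-1) k_(n-1) by
    gamma_(n+1) / (1 + a) k_(n-1) = beta_n gamma_n k_(n-1), and the definition
    of P2 gives lambda_n = lambda_(n-1) + gamma_n.  For n = 0, both d and nabla
    kill constants.

    The two facts on k_n come from the basis of binomial polynomials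
    binom(x, j).  There k_n has the coefficients
    (-r)^(n-j) binom(N-1-j, n-j) (krawtchouk_binom), the forward difference is
    the shift j -> j - 1, and d is bidiagonal.  The difference identity
    is then Pascal's rule for the coefficients, and the eigenvalue equation is
    the absorption rule m binom(y, m) = y binom(y-1, m-1).

    Genre.  The coefficients of the powers of d obey a three term recursion
    in which the exponents of the shifts grow by at most one, so the power j
    of d has its shifts between -j and j.  At the top shift k + 1 only the
    leading term of P1(d) contributes.  At the bottom shift - k - 1 both P1(d)
    and nabla P2(d) contribute, but their sum is the product of a
    nonzero polynomial and p x - c, where p is the leading coefficient of P1
    and c is a constant, so it does not cancel (genre_perturbed_nabla). *)

(** * Shifts of polynomials *)

Section Shifts.
Variable R : realType.
Implicit Types (f g p : {poly R}) (l : int).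

Lemma shiftD l f g : shift l (f + g) = shift l f + shift l g.
Proof. exact: comp_polyD. Qed.

Lemma shiftB l f g : shift l (f - g) = shift l f - shift l g.
Proof. exact: comp_polyB. Qed.

Lemma shiftM l f g : shift l (f * g) = shift l f * shift l g.
Proof. exact: comp_polyM. Qed.

Lemma shiftZ l (c : R) f : shift l (c *: f) = c *: shift l f.
Proof. exact: comp_polyZ. Qed.

Lemma shiftC l (c : R) : shift l c%:P = c%:P.
Proof. exact: comp_polyC. Qed.

Lemma shift_0 l : shift l (0 : {poly R}) = 0.
Proof. exact: comp_poly0. Qed.

Lemma shiftX l : shift l ('X : {poly R}) = 'X + (l%:~R)%:P.
Proof. exact: comp_polyX. Qed.

Lemma shift_sum l (I : finType) (F : I -> {poly R}) :
  shift l (\sum_i F i) = \sum_i shift l (F i).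
Proof. by rewrite /shift raddf_sum. Qed.

Lemma shift0 f : shift 0 f = f.
Proof. by rewrite /shift mulr0z addr0 comp_polyXr. Qed.

Lemma shift_shift l m f : shift l (shift m f) = shift (m + l) f.
Proof.
rewrite /shift -comp_polyA comp_polyD comp_polyX comp_polyC.
by rewrite intrD polyCD addrAC addrA.
Qed.

Lemma shift_neq0 l f : f != 0 -> shift l f != 0.
Proof.
apply: contraNneq => sf0; apply/eqP.
by rewrite -[f]shift0 -(subrr l) -shift_shift sf0 shift_0.
Qed.

Lemma nablaZ (c : R) f : nabla (c *: f) = c *: nabla f.
Proof. by rewrite /nabla shiftZ scalerBr. Qed.

Lemma nablaD f g : nabla (f + g) = nabla f + nabla g.
Proof. by rewrite /nabla shiftD opprD addrACA. Qed.

End Shifts.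

(** * Polynomials in a linear operator *)

Section PolyOp.
Variables (R : realType) (T : {poly R} -> {poly R}).
Hypothesis (TD : {morph T : f g / f + g}).
Hypothesis (TZ : forall (c : R) f, T (c *: f) = c *: T f).

Lemma poly_opD P : {morph poly_op P T : f g / f + g}.
Proof.
move=> f g; rewrite /poly_op -big_split /=; apply: eq_bigr => j _.
rewrite -scalerDr; congr (_ *: _).
by elim: (j : nat) => //= n ->; rewrite TD.
Qed.

Lemma poly_opZ P c f : poly_op P T (c *: f) = c *: poly_op P T f.
Proof.
rewrite /poly_op scaler_sumr; apply: eq_bigr => j _.
rewrite scalerA mulrC -scalerA; congr (_ *: _).
by elim: (j : nat) => //= n ->; rewrite TZ.
Qed.

Lemma poly_op_eigen P mu f :
  T f = mu *: f -> poly_op P T f = P.[mu] *: f.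
Proof.
move=> Tf; rewrite /poly_op horner_coef scaler_suml; apply: eq_bigr => j _.
rewrite -scalerA; congr (_ *: _).
elim: (j : nat) => [|n /= ->]; first by rewrite expr0 scale1r.
by rewrite TZ Tf scalerA exprSr.
Qed.

End PolyOp.

(** * Binomial polynomials *)

Section BinomialPoly.
Variable R : realType.

(** The generalised binomial coefficient binom(x, m) as a polynomial in x:
    one object serves as a basis of polynomials and, by evaluation, for the
    real numbers binom(N-1-j, m). *)
Definition binom_poly (m : nat) : {poly R} :=
  (m`!%:R)^-1 *: \prod_(i < m) ('X - i%:R).

Lemma binom_poly0 : binom_poly 0 = 1.
Proof. by rewrite /binom_poly big_ord0 fact0 invr1 scale1r. Qed.

Lemma fact_neq0 m : (m`!%:R : R) != 0.
Proof. by rewrite pnatr_eq0 -lt0n fact_gt0. Qed.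

Lemma binom_poly_rec m :
  m.+1%:R *: binom_poly m.+1 = ('X - m%:R) * binom_poly m.
Proof.
rewrite /binom_poly big_ord_recr /= scalerA -scalerAr factS natrM invfM mulrA.
by rewrite divff ?mul1r ?pnatr_eq0 // [in RHS]mulrC.
Qed.

(** Absorption rule (m+1) binom(x, m+1) = x binom(x-1, m): it makes x nabla
    diagonal on the binomial basis. *)
Lemma binom_poly_recX m :
  m.+1%:R *: binom_poly m.+1 = 'X * shift (-1) (binom_poly m).
Proof.
rewrite /binom_poly big_ord_recl /= scalerA shiftZ -scalerAr subr0.
rewrite factS natrM invfM mulrA divff ?mul1r ?pnatr_eq0 //.
congr (_ *: (_ * _)); rewrite /shift rmorph_prod; apply: eq_bigr => i _ /=.
rewrite comp_polyB comp_polyX -!polyC_natr comp_polyC mulrN1z polyCN.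
by rewrite /bump /= add1n -natr1 polyCD; ring.
Qed.

(** Pascal's rule: the forward difference lowers the index by one. *)
Lemma binom_poly_pascal m :
  shift 1 (binom_poly m.+1) = binom_poly m.+1 + binom_poly m.
Proof.
have n0 : m.+1%:R != 0 :> R by rewrite pnatr_eq0.
have sE : shift 1 (m.+1%:R *: binom_poly m.+1) = ('X + 1) * binom_poly m.
  by rewrite binom_poly_recX shiftM shift_shift addNr shift0 shiftX.
apply: (scalerI n0); rewrite -shiftZ sE scalerDr binom_poly_rec.
by rewrite -mul_polyC -mulrDl polyC_natr -natr1; congr (_ * _); ring.
Qed.

(** A rising factorial read backwards is a falling factorial. *)
Lemma pochhammer_binom (y : R) m :
  pochhammer y m = m`!%:R * (binom_poly m).[y + m%:R - 1].
Proof.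
rewrite /binom_poly hornerZ mulrA divff ?fact_neq0 // mul1r horner_prod.
rewrite /pochhammer (reindex_inj rev_ord_inj) /=; apply: eq_bigr => i _.
rewrite -polyC_natr !hornerE natrB // -natr1; ring.
Qed.

Lemma pochhammerNX m :
  pochhammer (- 'X) m = (-1) ^+ m * m`!%:R *: binom_poly m.
Proof.
rewrite /binom_poly scalerA mulfK ?fact_neq0 // /pochhammer.
rewrite -[m in (-1) ^+ m]card_ord -prodr_const -mul_polyC rmorph_prod.
rewrite -big_split.
by apply: eq_bigr => i _ /=; rewrite polyCN polyC1; ring.
Qed.

Lemma pochhammerS (A : pzRingType) (y : A) j :
  pochhammer y j.+1 = pochhammer y j * (y + j%:R).
Proof. by rewrite /pochhammer big_ord_recr. Qed.

Lemma pochhammerNn n j : (j <= n)%N ->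
  pochhammer (- n%:R : R) j = (-1) ^+ j * n`!%:R / (n - j)`!%:R.
Proof.
elim: j => [|j IH] lejn.
  by rewrite /pochhammer big_ord0 subn0 mul1r divff ?fact_neq0.
have nBj : (- n%:R + j%:R : R) = - (n - j)%:R.
  by rewrite natrB ?opprB 1?addrC // ltnW.
have nj0 : ((n - j)%:R : R) != 0 by rewrite pnatr_eq0 -lt0n subn_gt0.
rewrite pochhammerS IH ?(ltnW lejn) // nBj -(subnSK lejn) factS natrM subnSK //.
move: (n - j)%:R ((n - j.+1)`!%:R) (n`!%:R) nj0 (fact_neq0 (n - j.+1)).
by move=> u v w u0 v0; rewrite exprS; field; rewrite v0.
Qed.

End BinomialPoly.

(** * Krawtchouk polynomials in the binomial basis *)

Section Krawtchouk.
Variables (R : realType) (a N : R).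
Hypotheses (a_neq0 : a != 0) (a_neqN1 : a != -1).

Lemma addr1_neq0 : 1 + a != 0.
Proof. by rewrite addrC -[1]opprK subr_eq0. Qed.

(** The coefficient of binom(x, j) in k_n.  The value 0 for j > n lets k_n be
    summed over any long enough range, so that sums for different n, or with
    shifted indices, can be compared term by term. *)
Definition kraw_coef (n j : nat) : R :=
  if (j <= n)%N then
    (- (a / (1 + a))) ^+ (n - j) * (binom_poly R (n - j)).[N - 1 - j%:R]
  else 0.

(** The factors (-n)_j and (-x)_j carry the sign (-1)^j each, and the factorials
    left over turn (N-n)_(n-j) into binom(N-1-j, n-j). *)
Lemma krawtchouk_binom n m : (n < m)%N ->
  krawtchouk a N n = \sum_(j < m) kraw_coef n j *: binom_poly R j.
Proof.
move=> ltnm.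
rewrite [RHS](bigID (fun j : 'I_m => (j < n.+1)%N)) /=.
rewrite [X in _ + X]big1 ?addr0; last first.
  by move=> j; rewrite ltnS /kraw_coef => /negPf ->; rewrite scale0r.
rewrite -(big_ord_widen m (fun j => kraw_coef n j *: binom_poly R j)) //.
rewrite /krawtchouk scaler_sumr; apply: eq_bigr => -[j /=].
rewrite ltnS => lejn _.
rewrite pochhammerNX 2!scalerA; congr (_ *: _).
rewrite /kraw_coef lejn pochhammerNn // pochhammer_binom.
have -> : N - n%:R + (n - j)%:R - 1 = N - 1 - j%:R.
  by rewrite natrB //; ring.
have -> : j%:Z - n%:Z = - (n - j)%:Z by lia.
have -> : (-1) ^+ (n + j) = (-1) ^+ (n - j) :> R.
  by rewrite -signr_odd -[RHS]signr_odd oddB // oddD.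
rewrite -!exprnN.
have f1 := fact_neq0 R n; have f2 := fact_neq0 R j.
have f3 := fact_neq0 R (n - j); have a1 := addr1_neq0.
rewrite -[- (a / _)]mulN1r !exprMn exprVn.
have sj : (-1) ^+ j * (-1) ^+ j = 1 :> R by rewrite -exprMn mulrNN mulr1 expr1n.
have am : a ^+ (n - j) != 0 by rewrite expf_neq0.
have bm : (1 + a) ^+ (n - j) != 0 by rewrite expf_neq0.
move: ((-1) ^+ j) sj (a ^+ _) am ((1 + a) ^+ _) bm ((-1) ^+ (n - j)).
move=> s sj A A0 B B0 t.
move: (n`!%:R) f1 (j`!%:R) f2 ((n - j)`!%:R) f3 ((binom_poly R _).[_]).
move=> u u0 v v0 w w0 z.
(* s is the sign (-1)^j, present once in (-n)_j and once in (-x)_j. *)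
transitivity (s * s * (t * (A / B) * z)); last by rewrite sj mul1r.
by field; rewrite u0 v0 w0 A0 B0.
Qed.

Lemma krawtchouk_opD : {morph krawtchouk_op a N : f g / f + g}.
Proof. by move=> f g; rewrite /krawtchouk_op !shiftD; ring. Qed.

Lemma krawtchouk_opZ (c : R) f :
  krawtchouk_op a N (c *: f) = c *: krawtchouk_op a N f.
Proof. by rewrite /krawtchouk_op !shiftZ -!scalerAr !scalerBr. Qed.

Lemma binom_poly_pascal_val m (y : R) :
  (binom_poly R m.+1).[y + 1] = (binom_poly R m.+1).[y] + (binom_poly R m).[y].
Proof.
by rewrite -hornerD -binom_poly_pascal /shift horner_comp !hornerE.
Qed.

Lemma binom_poly_recX_val m (y : R) :
  m.+1%:R * (binom_poly R m.+1).[y] = y * (binom_poly R m).[y - 1].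
Proof.
rewrite -hornerZ binom_poly_recX /shift !hornerE.
by rewrite horner_comp !hornerE mulrN1z.
Qed.

Lemma kraw_coef_gt n j : (n < j)%N -> kraw_coef n j = 0.
Proof. by move=> ltnj; rewrite /kraw_coef leqNgt ltnj. Qed.

Lemma kraw_coef_diag n : kraw_coef n n = 1.
Proof. by rewrite /kraw_coef leqnn subnn binom_poly0 hornerC mulr1. Qed.

(** Pascal's rule at N-2-j; it is the coefficient form of nabla_krawtchouk. *)
Lemma kraw_coef_pascal n j :
  kraw_coef n.+1 j.+1 - a / (1 + a) * kraw_coef n j.+1 = kraw_coef n j.
Proof.
case: (ltngtP j n) => [ltjn|ltnj|->].
- rewrite /kraw_coef ltnS ltjn (ltnW ltjn) subSS -(subnSK ltjn) -natr1.
  set y := N - 1 - (j%:R + 1).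
  have -> : N - 1 - j%:R = y + 1 by rewrite /y; ring.
  by rewrite binom_poly_pascal_val exprS; ring.
- by rewrite !kraw_coef_gt ?mulr0 ?subr0 // ltnW.
- by rewrite !kraw_coef_diag kraw_coef_gt // mulr0 subr0.
Qed.

(** Absorption rule at N-1-j, where r (1 + a) = a cancels the extra factor -r.
    It is the coefficient form of the eigenvalue equation. *)
Lemma kraw_coef_step n j :
  a * (N - 1 - j%:R) * kraw_coef n j.+1
  = (j%:R - n%:R) * (1 + a) * kraw_coef n j.
Proof.
case: (ltngtP j n) => [ltjn|ltnj|->]; last 2 first.
- by rewrite !kraw_coef_gt ?mulr0 // ltnW.
- by rewrite kraw_coef_gt // subrr mulr0 !mul0r.
have -> : (j%:R - n%:R : R) = - (n - j)%:R by rewrite natrB ?opprB // ltnW.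
rewrite /kraw_coef ltjn (ltnW ltjn) -(subnSK ltjn) exprS.
rewrite -[j.+1%:R]natr1 opprD addrA.
set m := (n - j.+1)%N; set y := N - 1 - j%:R; set c := _ ^+ m.
have a1 := addr1_neq0.
transitivity (a * c * (y * (binom_poly R m).[y - 1])); first by ring.
by rewrite -binom_poly_recX_val; field.
Qed.

Lemma krawtchouk_op1 : krawtchouk_op a N 1 = 0.
Proof. by rewrite /krawtchouk_op -polyC1 !shiftC !polyC1; ring. Qed.

(** The operator is - x nabla - a (x - N + 1) Delta, with Delta the forward
    difference.  Here x nabla is diagonal, and Delta gives binom(x, j), on which
    multiplication by x - N + 1 = (x - j) + (j + 1 - N) has two terms. *)
Lemma krawtchouk_op_binom j :
  krawtchouk_op a N (binom_poly R j.+1)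
  = (- (1 + a) * j.+1%:R) *: binom_poly R j.+1
    + (a * (N - 1 - j%:R)) *: binom_poly R j.
Proof.
have sB : shift (-1) (binom_poly R j.+1)
          = binom_poly R j.+1 - shift (-1) (binom_poly R j).
  apply/eqP; rewrite eq_sym subr_eq -shiftD -binom_poly_pascal.
  by rewrite shift_shift addrN shift0.
rewrite /krawtchouk_op binom_poly_pascal shift0 sB mulrBr -binom_poly_recX.
set V := 'X - N%:P + 1.
have VB : V * binom_poly R j
          = j.+1%:R *: binom_poly R j.+1 - (N - 1 - j%:R) *: binom_poly R j.
  rewrite binom_poly_rec /V -mul_polyC -mulrBl; congr (_ * _).
  by rewrite !polyCB polyC_natr polyC1; ring.
rewrite -!scalerA -!mul_polyC in VB *.
set B := binom_poly R j.+1 in VB *; set C := binom_poly R j in VB *.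
transitivity (- (j.+1%:R%:P * B) - a%:P * (V * C)); first by ring.
by rewrite VB; ring.
Qed.

Lemma krawtchouk_op_sum (I : finType) (F : I -> {poly R}) :
  krawtchouk_op a N (\sum_i F i) = \sum_i krawtchouk_op a N (F i).
Proof.
apply: (big_morph _ krawtchouk_opD).
by have := krawtchouk_opZ 0 0; rewrite !scale0r.
Qed.

(** The diagonal part of the operator contributes - (1 + a) j and the lower part
    (j - n) (1 + a), by kraw_coef_step, to the coefficient of binom(x, j). *)
Lemma krawtchouk_eigen n :
  krawtchouk_op a N (krawtchouk a N n)
  = (- (n%:R * (1 + a))) *: krawtchouk a N n.
Proof.
rewrite [in LHS](@krawtchouk_binom n n.+2) //.
rewrite [in RHS](@krawtchouk_binom n n.+1) //.
rewrite krawtchouk_op_sum big_ord_recl krawtchouk_opZ binom_poly0 krawtchouk_op1.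
rewrite scaler0 add0r /=.
under eq_bigr => j _.
  rewrite krawtchouk_opZ krawtchouk_op_binom scalerDr 2!scalerA.
  rewrite [_ * (a * _)]mulrC kraw_coef_step /bump leq0n add1n.
  over.
(* The diagonal part, reindexed so that both parts are sums over binom(x, j):
   G 0 vanishes by its factor j, and G n.+1 because k_n has degree n. *)
pose G j := (kraw_coef n j * (- (1 + a) * j%:R)) *: binom_poly R j.
have GE : \sum_(j < n.+1) G j.+1 = \sum_(j < n.+1) G j.
  transitivity (\sum_(j < n.+2) G j).
    by rewrite [RHS]big_ord_recl /G mulr0 mulr0 scale0r add0r.
  by rewrite big_ord_recr /= /G kraw_coef_gt // mul0r scale0r addr0.
rewrite big_split /= [X in X + _]GE -big_split scaler_sumr /=.
apply: eq_bigr => j _; rewrite /G -scalerDl [RHS]scalerA; congr (_ *: _); ring.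
Qed.

Lemma krawtchouk_delta n m : (n < m.+1)%N ->
  shift 1 (krawtchouk a N n) - krawtchouk a N n
  = \sum_(j < m) kraw_coef n j.+1 *: binom_poly R j.
Proof.
move=> ltnm; rewrite (@krawtchouk_binom n m.+1) // shift_sum -sumrB.
rewrite big_ord_recl shiftZ binom_poly0 -polyC1 shiftC subrr add0r.
apply: eq_bigr => j _.
by rewrite shiftZ binom_poly_pascal -scalerBr addrAC subrr add0r.
Qed.

(** In terms of the forward difference Delta this reads
    Delta k_(n+1) - r Delta k_n = k_n, since nabla is Delta followed by the
    shift by -1 and 1 / (1 + a) = 1 - r.  Delta shifts coefficients, so this
    form is kraw_coef_pascal. *)
Lemma nabla_krawtchouk n :
  nabla (krawtchouk a N n.+1 + (1 / (1 + a)) *: krawtchouk a N n)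
  = krawtchouk a N n.
Proof.
set k' := krawtchouk a N n.+1; set k0 := krawtchouk a N n.
have fwd : shift 1 k' - k' - (a / (1 + a)) *: (shift 1 k0 - k0) = k0.
  rewrite (@krawtchouk_delta _ n.+1) // (@krawtchouk_delta _ n.+1) //.
  rewrite scaler_sumr -sumrB /k0 (@krawtchouk_binom n n.+1) //.
  by apply: eq_bigr => j _; rewrite scalerA -scalerBl kraw_coef_pascal.
move: k' k0 fwd => k' k0 /(congr1 (shift (-1))).
rewrite shiftB shiftZ !shiftB !shift_shift !addrN !shift0 nablaD nablaZ /nabla.
have -> : 1 / (1 + a) = 1 - a / (1 + a) by field; exact: addr1_neq0.
by move=> bwd; rewrite scalerBl scale1r addrCA bwd subrK.
Qed.

End Krawtchouk.

(** * Degree of a difference of translates *)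

Section CompSub.
Variable R : realType.

(** The difference factors as - h times a sum of n + 1 products
    (X - h)^(n-i) X^i, each monic of degree n. *)
Lemma coef_subX_exp (h : R) n m : (n <= m)%N ->
  (('X - h%:P) ^+ n.+1 - 'X ^+ n.+1 : {poly R})`_m
  = if m == n then - h *+ n.+1 else 0.
Proof.
move=> lenm; rewrite subrXX addrAC subrr add0r mulNr coefN coefCM coef_sum.
have mon i : (i < n.+1)%N ->
    ('X - h%:P) ^+ (n.+1.-1 - i) * 'X^i \is @monic R /\
    size (('X - h%:P) ^+ (n.+1.-1 - i) * 'X^i) = n.+1.
  rewrite ltnS => lein.
  have m1 : ('X - h%:P) ^+ (n.+1.-1 - i) \is @monic R.
    by rewrite monic_exp // monicXsubC.
  split; first by rewrite rpredM ?monicXn.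
  by rewrite size_Mmonic ?monicXn ?monic_neq0 // size_exp_XsubC size_polyXn; lia.
rewrite (eq_bigr (fun=> (m == n)%:R)) => [|[i ltin] _] /=.
  rewrite sumr_const card_ord; case: eqP => _; rewrite ?mul0rn ?mulr0 ?oppr0 //.
  by rewrite mulr_natr mulNrn.
have [/monicP lc sz] := mon i ltin.
case: eqP => [->|/eqP neq_mn].
  by move: lc; rewrite lead_coefE sz.
by rewrite nth_default // sz ltn_neqAle eq_sym neq_mn.
Qed.

Lemma size_comp_sub (P : {poly R}) (h : R) k :
  h != 0 -> size P = k.+2 -> size (P \Po ('X - h%:P) - P) = k.+1.
Proof.
move=> h0 szP.
have cE m : (k <= m)%N ->
    (P \Po ('X - h%:P) - P)`_m = if m == k then P`_k.+1 * (- h *+ k.+1) else 0.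
  move=> lekm.
  have -> : P \Po ('X - h%:P) - P
            = \sum_(i < k.+2) P`_i *: (('X - h%:P) ^+ i - 'X^i).
    rewrite -[in X in _ - X](comp_polyXr P) !comp_polyE szP -sumrB.
    by apply: eq_bigr => i _; rewrite scalerBr.
  rewrite coef_sum big_ord_recl expr0 subrr scaler0 coef0 add0r.
  rewrite big_ord_recr big1 => [|i _] /=; rewrite coefZ coef_subX_exp //.
  - by rewrite add0r; case: eqP => // _; rewrite mulr0.
  - by have := ltn_ord i; case: eqP => [mi|_ _]; rewrite ?mulr0 //; lia.
  - by apply: leq_trans lekm; rewrite /bump; have := ltn_ord i; lia.
apply/eqP; rewrite eqn_leq; apply/andP; split.
  by apply/leq_sizeP => m ltkm; rewrite cE 1?ltnW // gtn_eqF.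
rewrite ltnNge; apply/negP => /leq_sizeP/(_ k (leqnn k)).
rewrite cE // eqxx => /eqP; rewrite mulf_eq0 mulrn_eq0 oppr_eq0 (negPf h0) !orbF.
by rewrite -[k.+1]/(k.+2.-1) -szP -lead_coefE lead_coef_eq0 -size_poly_eq0 szP.
Qed.

End CompSub.

(** * Sums over symmetric windows of integers *)

Section WindowSum.
Variables (V : nmodType).
Implicit Types F : int -> V.

Definition supported (m : nat) F := forall l : int, (m < absz l)%N -> F l = 0.

Definition window_sum (m : nat) F : V := \sum_(i < (2 * m).+1) F (i%:Z - m%:Z).

Lemma supportedW m n F : (m <= n)%N -> supported m F -> supported n F.
Proof. by move=> lemn sF l ltnl; apply: sF; apply: leq_ltn_trans ltnl. Qed.

(** A translation by at most one step keeps the support inside the window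
    enlarged by one on each side; e = 0 is plain enlargement. *)
Lemma window_sum_shift (e : int) m F : (absz e <= 1)%N -> supported m F ->
  window_sum m.+1 (fun l => F (l - e)) = window_sum m F.
Proof.
move=> le1 sF; rewrite /window_sum.
have -> : ((2 * m.+1).+1 = (2 * m).+3)%N by lia.
have [e0|[e1|e1]] : e = 0 \/ e = 1 \/ e = -1 by lia.
- rewrite big_ord_recl big_ord_recr /= sF ?add0r; last by lia.
  rewrite [X in _ + X]sF ?addr0; last by rewrite /bump; lia.
  by apply: eq_bigr => i _; congr F; rewrite /bump /=; lia.
- rewrite 2!big_ord_recl /= sF ?add0r; last by lia.
  rewrite sF ?add0r; last by rewrite /bump; lia.
  by apply: eq_bigr => i _; congr F; rewrite /bump /=; lia.
- rewrite 2!big_ord_recr /= [X in _ + X]sF ?addr0; last by lia.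
  rewrite [X in _ + X]sF ?addr0; last by lia.
  by apply: eq_bigr => i _; congr F; rewrite /=; lia.
Qed.

Lemma window_sum_widen m n F :
  supported m F -> (m <= n)%N -> window_sum n F = window_sum m F.
Proof.
move=> sF; elim: n => [|n IH]; first by rewrite leqn0 => /eqP <-.
rewrite leq_eqVlt => /orP[/eqP <- //|]; rewrite ltnS => lemn.
rewrite -IH // -(@window_sum_shift 0 n) //; last exact: supportedW sF.
by apply: eq_bigr => i _; rewrite subr0.
Qed.

End WindowSum.

(** * Difference operators with a symmetric window of shifts *)

Section DifferenceOperators.
Variable R : realType.
Implicit Types (c d : int -> {poly R}) (f : {poly R}).

Definition diffop (m : nat) c f : {poly R} :=
  window_sum m (fun l => c l * shift l f).

Lemma diffop_widen m n c f :
  supported m c -> (m <= n)%N -> diffop n c f = diffop m c f.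
Proof.
by move=> sc; apply: window_sum_widen => l ltml; rewrite sc ?mul0r.
Qed.

Lemma diffopD m c d f : 
  diffop m c f + diffop m d f = diffop m (fun l => c l + d l) f.
Proof. by rewrite -big_split; apply: eq_bigr => i _; rewrite mulrDl. Qed.

Lemma diffopM m (p : {poly R}) c f :
  p * diffop m c f = diffop m (fun l => p * c l) f.
Proof.
rewrite /diffop /window_sum mulr_sumr.
by apply: eq_bigr => i _; rewrite mulrA.
Qed.

(** Moving a shift across a difference operator shifts its coefficients and
    translates their index. *)
Lemma shift_diffop (e : int) m c f : (absz e <= 1)%N -> supported m c ->
  shift e (diffop m c f) = diffop m.+1 (fun l => shift e (c (l - e))) f.
Proof.
move=> le1 sc; pose F (l : int) := shift e (c l * shift l f).
transitivity (window_sum m F); first exact: shift_sum.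
rewrite -(@window_sum_shift _ e) //.
  by apply: eq_bigr => i _; rewrite /F shiftM shift_shift subrK.
by move=> l ltml; rewrite /F sc // mul0r shift_0.
Qed.

Lemma has_genre_diffop m c (T : {poly R} -> {poly R}) :
  c (- m%:Z) != 0 -> c m%:Z != 0 -> (forall f, T f = diffop m c f) ->
  has_genre T (- m%:Z) m%:Z.
Proof.
move=> cb ct TE; split; first by lia.
exists c; split=> // f; rewrite TE /diffop /window_sum.
have -> : absz (m%:Z - - m%:Z) = (2 * m)%N by lia.
by apply: eq_bigr => i _; rewrite addrC.
Qed.

End DifferenceOperators.

(** * Coefficients of polynomials in the Krawtchouk operator *)

Section KrawtchoukPowers.
Variables (R : realType) (a N : R).
Implicit Types (P f : {poly R}).

(** The coefficient of the shift by l in the power j of the operator. *)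
Fixpoint kraw_pow_coef (j : nat) (l : int) : {poly R} :=
  if j is i.+1 then
    'X * shift (-1) (kraw_pow_coef i (l + 1))
    - ('X - a *: ('X - N%:P + 1)) * kraw_pow_coef i l
    - (a *: ('X - N%:P + 1)) * shift 1 (kraw_pow_coef i (l - 1))
  else (l == 0)%:R.

Lemma kraw_pow_coefS j l :
  kraw_pow_coef j.+1 l
  = 'X * shift (-1) (kraw_pow_coef j (l + 1))
    - ('X - a *: ('X - N%:P + 1)) * kraw_pow_coef j l
    - (a *: ('X - N%:P + 1)) * shift 1 (kraw_pow_coef j (l - 1)).
Proof. by []. Qed.

Lemma kraw_pow_coef_supported j : supported j (kraw_pow_coef j).
Proof.
elim: j => [|j IH] l ltjl /=; first by case: eqP => // l0; lia.
by rewrite !IH ?shift_0 ?mulr0 ?subrr //; lia.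
Qed.

Lemma iter_krawtchouk_op j f :
  iter j (krawtchouk_op a N) f = diffop j (kraw_pow_coef j) f.
Proof.
elim: j => [|j IH].
  by rewrite /diffop /window_sum big_ord1 subrr /= mul1r shift0.
have sj := @kraw_pow_coef_supported j.
rewrite iterS IH /krawtchouk_op !shift_diffop // -!mulNr !diffopM !diffopD.
by apply: eq_bigr => i _; rewrite /= !mulNr opprK !subr0 shift0.
Qed.

Definition poly_op_coef P (l : int) : {poly R} :=
  \sum_(j < size P) P`_j *: kraw_pow_coef j l.

Lemma poly_op_coef_supported P m : (size P <= m.+1)%N ->
  supported m (poly_op_coef P).
Proof.
move=> szP l ltml; apply: big1 => j _.
by rewrite kraw_pow_coef_supported ?scaler0 //; have := ltn_ord j; lia.
Qed.

Lemma poly_op_diffop P m f : (size P <= m.+1)%N ->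
  poly_op P (krawtchouk_op a N) f = diffop m (poly_op_coef P) f.
Proof.
move=> szP; rewrite /poly_op.
transitivity (\sum_(j < size P) P`_j *: diffop m (kraw_pow_coef j) f).
  apply: eq_bigr => j _; rewrite iter_krawtchouk_op (@diffop_widen _ j m) //.
    exact: kraw_pow_coef_supported.
  by have := ltn_ord j; lia.
rewrite /diffop /window_sum.
under eq_bigr do rewrite scaler_sumr.
rewrite exchange_big /=; apply: eq_bigr => i _.
rewrite /poly_op_coef mulr_suml.
by apply: eq_bigr => j _; rewrite scalerAl.
Qed.

(** Powers below the degree do not reach the shifts of size m. *)
Lemma poly_op_coef_extreme P m l : size P = m.+1 -> (m <= absz l)%N ->
  poly_op_coef P l = lead_coef P *: kraw_pow_coef m l.
Proof.
move=> szP leml; rewrite lead_coefE /poly_op_coef szP big_ord_recr big1 /= ?add0r //.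
by move=> j _; rewrite kraw_pow_coef_supported ?scaler0 //; have := ltn_ord j; lia.
Qed.

Lemma kraw_pow_coef_top j :
  a != 0 -> kraw_pow_coef j j%:Z != 0.
Proof.
move=> a0; elim: j => [|j IH] /=; first exact: oner_neq0.
have sj := @kraw_pow_coef_supported j.
rewrite [kraw_pow_coef j (_ + 1)]sj ?[kraw_pow_coef j j.+1%:Z]sj; try lia.
rewrite shift_0 !mulr0 subrr sub0r.
have -> : j.+1%:Z - 1 = j%:Z by lia.
rewrite oppr_eq0 mulf_neq0 ?shift_neq0 // scaler_eq0 negb_or a0 /=.
by rewrite -addrA -polyC1 -polyCN -polyCD -size_poly_eq0 size_XaddC.
Qed.

Lemma kraw_pow_coef_botS j :
  kraw_pow_coef j.+1 (- j.+1%:Z) = 'X * shift (-1) (kraw_pow_coef j (- j%:Z)).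
Proof.
have sj := @kraw_pow_coef_supported j.
rewrite kraw_pow_coefS [kraw_pow_coef j (_ - 1)]sj; last by lia.
rewrite [kraw_pow_coef j (- j.+1%:Z)]sj; last by lia.
by rewrite shift_0 !mulr0 !subr0; have -> : - j.+1%:Z + 1 = - j%:Z by lia.
Qed.

Lemma kraw_pow_coef_bot j : kraw_pow_coef j (- j%:Z) != 0.
Proof.
elim: j => [|j IH]; first by rewrite oppr0 oner_neq0.
by rewrite kraw_pow_coef_botS mulf_neq0 ?polyX_eq0 ?shift_neq0.
Qed.

End KrawtchoukPowers.

(** The scalar s is arbitrary: the lowest coefficients of P(d) and nabla Q(d)
    share a nonzero factor, and what remains is p x against a constant. *)
Lemma genre_perturbed_nabla (R : realType) (a N s : R) (k : nat)
    (P Q : {poly R}) :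
  a != 0 -> size P = k.+2 -> size Q = k.+1 ->
  has_genre (fun f => poly_op P (krawtchouk_op a N) f
                      + s *: nabla (poly_op Q (krawtchouk_op a N) f))
            (- k.+1%:Z) k.+1%:Z.
Proof.
move=> a0 szP szQ.
pose cP := poly_op_coef a N P; pose cQ := poly_op_coef a N Q.
have sQ : supported k cQ by apply: poly_op_coef_supported; rewrite szQ.
pose c (l : int) := cP l + s%:P * (cQ l - shift (-1) (cQ (l + 1))).
(* P(d) ends with X * shift (-1) u and nabla Q(d) with - shift (-1) u, up to
   scalars, where u is the lowest coefficient of the power k. *)
have cbot : c (- k.+1%:Z)
    = shift (-1) (kraw_pow_coef a N k (- k%:Z))
      * (lead_coef P *: 'X - (s * lead_coef Q)%:P).
  rewrite /c [cQ (- _)]sQ; last by lia.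
  have -> : - k.+1%:Z + 1 = - k%:Z by lia.
  rewrite /cP /cQ (@poly_op_coef_extreme _ _ _ P k.+1) ?szP //.
  rewrite (@poly_op_coef_extreme _ _ _ Q k) ?szQ //; last by lia.
  rewrite kraw_pow_coef_botS shiftZ -!mul_polyC polyCM; ring.
have ctop : c k.+1%:Z = lead_coef P *: kraw_pow_coef a N k.+1 k.+1%:Z.
  rewrite /c [cQ k.+1%:Z]sQ; last by lia.
  rewrite sQ; last by lia.
  rewrite shift_0 subrr mulr0 addr0 /cP.
  by rewrite (@poly_op_coef_extreme _ _ _ _ k.+1) ?szP.
have lP0 : lead_coef P != 0 by rewrite lead_coef_eq0 -size_poly_eq0 szP.
apply: (@has_genre_diffop _ _ c).
- rewrite cbot mulf_neq0 ?shift_neq0 ?kraw_pow_coef_bot //.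
  (* The coefficient of X in the second factor is lead_coef P. *)
  apply/eqP => /(congr1 (fun p : {poly R} => p`_1)) /eqP.
  by rewrite coefB coefZ coefX coefC subr0 mulr1 coef0; apply/negP.
- by rewrite ctop scaler_eq0 negb_or lP0 kraw_pow_coef_top.
move=> f; rewrite (@poly_op_diffop _ _ _ _ k.+1) ?szP //.
rewrite /nabla (@poly_op_diffop _ _ _ _ k) ?szQ // shift_diffop //.
rewrite -(@diffop_widen _ k k.+1) // -mul_polyC -[- diffop _ _ _]mulN1r.
rewrite diffopM diffopD diffopM diffopD; apply: eq_bigr => i _.
by rewrite /c opprK mulN1r.
Qed.

(** * Eigenfunctions and genre of the perturbed operator *)

Theorem theorem6p2 (R : realType) (a N : R) (k : nat) (P1 P2 : {poly R})
    (gamma lambda beta : nat -> R) (q : nat -> {poly R})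
    (D : {poly R} -> {poly R})
    (a_neq0 : a != 0) (a_neqN1 : a != -1)
    (k_ge1 : (1 <= k)%N)
    (degP1 : size P1 = k.+2)
    (P2E : P2 = P1 \Po ('X - (1 + a)%:P) - P1)
    (P2_neq0 : forall n : nat, P2.[- (n%:R * (1 + a))] != 0)
    (gammaE : forall n : nat, gamma n.+1 = P2.[- (n%:R * (1 + a))])
    (lambdaE : forall n : nat, lambda n = P1.[- (n%:R * (1 + a))])
    (betaE : forall n : nat, (1 <= n)%N ->
       beta n = 1 / (1 + a) * (gamma n.+1 / gamma n))
    (q0E : q 0%N = 1)
    (qE : forall n : nat, (1 <= n)%N ->
       q n = krawtchouk a N n + beta n *: krawtchouk a N n.-1)
    (DE : forall f : {poly R},
       D f = poly_op P1 (krawtchouk_op a N) f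
             + (1 / (1 + a)) *: nabla (poly_op P2 (krawtchouk_op a N) f)) :
  [/\ size P2 = k.+1,
      has_order D (2 * k + 2),
      has_genre D (- k%:Z - 1) (k%:Z + 1) &
      forall n : nat, D (q n) = lambda n *: q n].
Proof.
have a1 : 1 + a != 0 by exact: addr1_neq0.
have szP2 : size P2 = k.+1 by rewrite P2E; apply: size_comp_sub.
have genre : has_genre D (- k%:Z - 1) (k%:Z + 1).
  have -> : - k%:Z - 1 = - k.+1%:Z by lia.
  have -> : k%:Z + 1 = k.+1%:Z by lia.
  have [le_sr [c [cs cr cE]]] :=
    genre_perturbed_nabla N (1 / (1 + a)) a_neq0 degP1 szP2.
  by split=> //; exists c; split=> // f; rewrite DE cE.
split=> //.
  by exists (- k%:Z - 1), (k%:Z + 1); split=> //; lia.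
have kTD := krawtchouk_opD a N; have kTZ := krawtchouk_opZ a N.
have P_k P n : poly_op P (krawtchouk_op a N) (krawtchouk a N n)
               = P.[- (n%:R * (1 + a))] *: krawtchouk a N n.
  exact/poly_op_eigen/krawtchouk_eigen.
case=> [|n].
  rewrite q0E DE lambdaE.
  have op1 P : poly_op P (krawtchouk_op a N) 1 = P.[0] *: 1.
    by apply: poly_op_eigen => //; rewrite krawtchouk_op1 scale0r.
  rewrite !op1 mul0r oppr0 nablaZ.
  by rewrite /nabla -polyC1 shiftC subrr !scaler0 addr0.
have g0 : gamma n.+1 != 0 by rewrite gammaE.
have lambdaB : lambda n.+1 = lambda n + gamma n.+1.
  rewrite gammaE P2E hornerD hornerN horner_comp hornerXsubC !lambdaE.
  rewrite addrCA subrr addr0.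
  by congr P1.[_]; rewrite -natr1; ring.
have gb : gamma n.+2 / (1 + a) = beta n.+1 * gamma n.+1.
  by rewrite betaE //; field; rewrite g0.
have P_q P : poly_op P (krawtchouk_op a N) (q n.+1)
    = P.[- (n.+1%:R * (1 + a))] *: krawtchouk a N n.+1
      + beta n.+1 *: (P.[- (n%:R * (1 + a))] *: krawtchouk a N n).
  rewrite qE // poly_opD // P_k; congr (_ + _).
  by rewrite (poly_opZ kTZ) P_k.
rewrite DE !P_q -!lambdaE -!gammaE qE //=.
have := nabla_krawtchouk N a_neq0 a_neqN1 n.
move: (krawtchouk a N n.+1) (krawtchouk a N n) => k1 k0 nabla_k.
have -> : gamma n.+2 *: k1 + beta n.+1 *: (gamma n.+1 *: k0)
          = gamma n.+2 *: (k1 + (1 / (1 + a)) *: k0).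
  by rewrite scalerDr !scalerA -gb mul1r.
rewrite nablaZ nabla_k !scalerA mul1r [_^-1 * _]mulrC gb lambdaB.
by rewrite -!mul_polyC; ring.
Qed.
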